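(* Let $\delta>0$ and let $\mathcal{M}^{(1)},\mathcal{M}^{(2)}$ be two RMMDPs on the same $\mathcal S,\mathcal A,\mathcal Z$ and horizon $H$, with the same transition kernel $T$ and the same initial state distribution $\nu$, but with possibly different mixing weights and latent reward models and with $M_1$ and $M_2$ latent contexts respectively. Let $d:=\min(H,M_1+M_2-1)$ and define $$\mathcal X_d:=\Big\{\mathbf x\in(\mathcal S\times\mathcal A)^{d}\ :\ \forall\,\mathbf z\in\mathcal Z^{d},\ \max_{\mathcal I\subseteq[d]}\big|\mathbf M^{(1)}(\mathbf x_{\mathcal I},\mathbf z_{\mathcal I})-\mathbf M^{(2)}(\mathbf x_{\mathcal I},\mathbf z_{\mathcal I})\big|\le\delta\Big\},$$ $$\mathcal E_{\rm tot}:=\Big\{x_{1:H}\in(\mathcal S\times\mathcal A)^{H}\ :\ \forall\,1\le t_1<\dots<t_d\le H,\ (x_{t_q})_{q=1}^{d}\in\mathcal X_d\Big\}.$$ Then for every subset $\mathcal E\subseteq\mathcal E_{\rm tot}$ and every history-dependent policy $\pi\in\Pi$, $$\sum_{\tau:\,x_{1:H}\in\mathcal E}\big|\mathbb P^{(1)}_\pi(\tau)-\mathbb P^{(2)}_\pi(\tau)\big|\le\sup_{\pi'\in\Pi}\mathbb P^{(1)}_{\pi'}(x_{1:H}\in\mathcal E)\cdot(4HZ)^{d}\cdot\delta .$$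
   Context: An RMMDP (reward-mixing MDP) $\mathcal M=(\mathcal S,\mathcal A,T,\nu,\{w_m\}_{m=1}^M,\{\mu_m\}_{m=1}^M)$ has finite state space $\mathcal S$ ($S=|\mathcal S|$), finite action space $\mathcal A$ ($A=|\mathcal A|$), transition kernel $T(s'|s,a)$, initial distribution $\nu$, mixing weights $w_m\ge0$ summing to $1$, and reward models $\mu_m(s,a,z)=\mathbb P(r=z\mid m,s,a)$ supported on a finite set $\mathcal Z\subset[-1,1]$ with $Z=|\mathcal Z|$. An episode of horizon $H$: a latent context $m$ is drawn with probability $w_m$ (unobserved), $s_1\sim\nu$, and for $t=1,\dots,H$ the agent chooses $a_t$, receives $r_t\sim\mu_m(s_t,a_t,\cdot)$ and (if $t<H$) $s_{t+1}\sim T(\cdot|s_t,a_t)$. Write $x_t=(s_t,a_t)$, $\tau=(s_t,a_t,r_t)_{t=1}^H$, and $h_t=(s_1,a_1,r_1,\dots,s_{t-1},a_{t-1},r_{t-1},s_t)$. $\Pi$ is the class of all history-dependent (possibly randomized) policies $\pi(a_t\mid h_t)$. For $\pi\in\Pi$, $\mathbb P_\pi(\tau)=\nu(s_1)\prod_{t=1}^{H-1}T(s_{t+1}|s_t,a_t)\prod_{t=1}^H\pi(a_t|h_t)\sum_{m}w_m\prod_{t=1}^H\mu_m(x_t,r_t)$, and $\mathbb P_\pi(x_{1:H}\in\mathcal E)$ is the probability that the state–action part of the trajectory lies in $\mathcal E$. For sequences $\mathbf x=(x_i)_{i=1}^q\in(\mathcal S\times\mathcal A)^q$, $\mathbf z=(z_i)_{i=1}^q\in\mathcal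 Z^q$, the moment is $\mathbf M(\mathbf x,\mathbf z)=\sum_m w_m\prod_{i=1}^q\mu_m(x_i,z_i)$ (equal to $1$ for the empty sequence); for $\mathcal I\subseteq[q]$, $\mathbf x_{\mathcal I}=(x_i)_{i\in\mathcal I}$ is the subsequence at positions $\mathcal I$. Superscripts $(1),(2)$ refer to quantities of $\mathcal M^{(1)},\mathcal M^{(2)}$. *)

(* Defs.v *)
From HB Require Import structures.
From mathcomp Require Import all_boot all_order all_algebra.
From mathcomp Require Import boolp classical_sets reals.
Set Implicit Arguments. Unset Strict Implicit. Unset Printing Implicit Defensive.
Import Order.TTheory GRing.Theory Num.Theory.
Local Open Scope ring_scope.

Section RMMDP.
Variables (R : realType) (S A Zt : finType).

Definition is_dist (T : finType) (p : T -> R) :=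
  (forall t, 0 <= p t) /\ \sum_t p t = 1.

Definition is_kernel (Tk : S -> A -> S -> R) := forall s a, is_dist (Tk s a).

Definition is_reward_model M (mu : 'I_M -> S -> A -> Zt -> R) :=
  forall m s a, is_dist (mu m s a).

(* the finite reward set Z is (an injective copy of) a subset of [-1,1] *)
Definition is_reward_support (zval : Zt -> R) :=
  injective zval /\ forall z, -1 <= zval z <= 1.

(* a history h_t = (s_1,a_1,r_1,...,s_{t-1},a_{t-1},r_{t-1}, s_t) is
   represented by the sequence of past triples together with s_t *)
Definition policy := seq (S * A * Zt) -> S -> A -> R.
Definition is_policy : set policy := fun pi => forall h s, is_dist (pi h s).

Section Traj.
Variables (H : nat) (Tk : S -> A -> S -> R) (nu : S -> R).

Definition init_factor (tau : seq (S * A * Zt)) :=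
  if tau is x :: _ then nu x.1.1 else 1.

Definition trans_factor (tau : seq (S * A * Zt)) :=
  \prod_(p <- zip tau (behead tau)) Tk p.1.1.1 p.1.1.2 p.2.1.1.

Definition policy_factor (pi : policy) (tau : H.-tuple (S * A * Zt)) :=
  \prod_(i < H) pi (take i tau) (tnth tau i).1.1 (tnth tau i).1.2.

Definition mixture_factor M (w : 'I_M -> R) (mu : 'I_M -> S -> A -> Zt -> R)
  (tau : H.-tuple (S * A * Zt)) :=
  \sum_(m < M) w m * \prod_(i < H) mu m (tnth tau i).1.1 (tnth tau i).1.2 (tnth tau i).2.

Definition traj_prob M (w : 'I_M -> R) (mu : 'I_M -> S -> A -> Zt -> R)
  (pi : policy) (tau : H.-tuple (S * A * Zt)) :=
  init_factor tau * trans_factor tau * policy_factor pi tau * mixture_factor w mu tau.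

Definition sa_part (tau : H.-tuple (S * A * Zt)) : H.-tuple (S * A) :=
  map_tuple (fun x => x.1) tau.

Definition event_prob M (w : 'I_M -> R) (mu : 'I_M -> S -> A -> Zt -> R)
  (pi : policy) (E : {set H.-tuple (S * A)}) :=
  \sum_(tau : H.-tuple (S * A * Zt) | sa_part tau \in E) traj_prob w mu pi tau.
End Traj.

Definition moment M (w : 'I_M -> R) (mu : 'I_M -> S -> A -> Zt -> R)
  (x : seq (S * A)) (z : seq Zt) :=
  \sum_(m < M) w m * \prod_(p <- zip x z) mu m p.1.1 p.1.2 p.2.

Definition subseq_at (T : Type) n (x : n.-tuple T) (I : {set 'I_n}) : seq T :=
  [seq tnth x i | i <- enum I].

Definition in_Xd d M1 (w1 : 'I_M1 -> R) (mu1 : 'I_M1 -> S -> A -> Zt -> R)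
  M2 (w2 : 'I_M2 -> R) (mu2 : 'I_M2 -> S -> A -> Zt -> R) (delta : R)
  (x : d.-tuple (S * A)) :=
  forall (z : d.-tuple Zt) (I : {set 'I_d}),
    `|moment w1 mu1 (subseq_at x I) (subseq_at z I)
      - moment w2 mu2 (subseq_at x I) (subseq_at z I)| <= delta.

Definition in_Etot H d M1 (w1 : 'I_M1 -> R) (mu1 : 'I_M1 -> S -> A -> Zt -> R)
  M2 (w2 : 'I_M2 -> R) (mu2 : 'I_M2 -> S -> A -> Zt -> R) (delta : R)
  (x : H.-tuple (S * A)) :=
  forall t : d.-tuple 'I_H, sorted (fun i j : 'I_H => (i < j)%N) t ->
    in_Xd w1 mu1 w2 mu2 delta [tuple tnth x (tnth t q) | q < d].

End RMMDP.

(* Main.v *)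
Require Import Defs.
From HB Require Import structures.
From mathcomp Require Import all_boot all_order all_algebra.
From mathcomp Require Import boolp classical_sets reals.
From mathcomp Require Import ring.
Import Order.TTheory GRing.Theory Num.Theory.

(** The two models share the factor [G tau] of transitions and actions, and the
    mixture factors differ by a signed sum [\sum_m u_m \prod_i mu_m(x_i, z_i)] over
    the [M1 + M2] contexts of both models. Pick a context [L] and, at the first
    remaining time [t], write [mu_m = mu_L + (mu_m - mu_L)]. The first part moves
    the factor [mu_L] into the prefix; the second kills the context [L], and its
    weights [u_m (mu_m - mu_L)] have moments of order [k] bounded by twice the bound
    on the moments of order [k + 1]. With [n] remaining times and moments of order up
    to [k] at most [delta], this yields [V (1 + 2 n Z)^k delta], where [V] bounds the
    sum of [G] against every product of reward kernels, each time being given its own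
    kernel (one of the [mu_m], or the uniform one, which costs the factor [Z]). Such a
    sum is the probability of the event under a policy that simulates its own
    rewards, because transitions ignore rewards; hence [V] is the supremum over
    policies. *)

Set Implicit Arguments. Unset Strict Implicit. Unset Printing Implicit Defensive.
Local Open Scope ring_scope.

(** * Sums over all completions of a sequence of first components *)

Section Lifts.
Variables (R : realType) (P Q : finType).
Implicit Types (x : seq P) (h : seq (P * Q)) (F : seq (P * Q) -> R).

Fixpoint sum_lifts x F : R :=
  if x is p :: x' then \sum_q sum_lifts x' (fun h => F ((p, q) :: h)) else F [::].

Lemma eq_sum_lifts x F1 F2 :
  F1 =1 F2 -> sum_lifts x F1 = sum_lifts x F2.
Proof.
elim: x F1 F2 => [|p x IH] F1 F2 eqF /=; first exact: eqF.
by apply: eq_bigr => q _; apply: IH => h; exact: eqF.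
Qed.

Lemma sum_lifts_ge0 x F : (forall h, 0 <= F h) -> 0 <= sum_lifts x F.
Proof. by elim: x F => [|p x IH] F F0 //=; apply: sumr_ge0 => q _; exact: IH. Qed.

Lemma sum_lifts_sum (I : finType) x (F : I -> seq (P * Q) -> R) :
  sum_lifts x (fun h => \sum_i F i h) = \sum_i sum_lifts x (F i).
Proof.
elim: x F => [//|p x IH] F /=.
by rewrite exchange_big /=; apply: eq_bigr => q _; rewrite IH.
Qed.

Lemma sum_liftsZ x c F : sum_lifts x (fun h => c * F h) = c * sum_lifts x F.
Proof.
elim: x F => [//|p x IH] F /=.
by rewrite mulr_sumr; apply: eq_bigr => q _; rewrite IH.
Qed.

Lemma sum_lifts_rcons x p F :
  sum_lifts (rcons x p) F = sum_lifts x (fun h => \sum_q F (rcons h (p, q))).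
Proof. by elim: x F => [//|p' x IH] F /=; apply: eq_bigr => q _; rewrite IH. Qed.

(** Turns a sum over a fibre of the projection into a recursive sum, so that later inductions run on
    plain sequences. *)
Lemma sum_tuple_lifts n (x : n.-tuple P) F :
  \sum_(tau : n.-tuple (P * Q) | map_tuple fst tau == x) F tau = sum_lifts x F.
Proof.
elim: n x F => [|n IH] x F.
  rewrite (tuple0 x) /= (big_pred1 [tuple]) // => tau.
  by apply/eqP/eqP => _; [rewrite (tuple0 tau)|rewrite (tuple0 (map_tuple fst tau))].
case/tupleP: x => p x /=.
rewrite (reindex (fun y : (P * Q) * n.-tuple (P * Q) => [tuple of y.1 :: y.2])) /=; last first.
  exists (fun tau : n.+1.-tuple (P * Q) => (thead tau, [tuple of behead tau])) => [[a t] _|tau _].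
    by rewrite /= theadE; congr pair; apply: val_inj.
  by rewrite -tuple_eta.
rewrite (eq_bigl (fun y : (P * Q) * n.-tuple (P * Q) =>
   (y.1.1 == p) && (map_tuple fst y.2 == x))); last first.
  by move=> [[a b] t] /=; rewrite -!val_eqE /= eqseq_cons.
rewrite -(pair_big_dep (fun a : P * Q => a.1 == p)
  (fun _ (t : n.-tuple (P * Q)) => map_tuple fst t == x)
  (fun a t => F (a :: t))) /=.
transitivity (\sum_(a | a == p) \sum_b
    \sum_(t : n.-tuple (P * Q) | map_tuple fst t == x) F ((a, b) :: t)).
  rewrite [RHS]pair_big /=.
  rewrite [LHS](eq_bigl (fun a : P * Q => (a.1 == p) && true)); first by apply: eq_bigr => -[].
  by move=> a; rewrite andbT.
rewrite big_pred1_eq; apply: eq_bigr => q _.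
exact: (IH x (fun h => F ((p, q) :: h))).
Qed.

End Lifts.

(** * Products whose factors depend on the past *)

Section PrefixProduct.
Variables (R : realType) (X : Type).
Implicit Types (f : seq X -> X -> R) (h : seq X).

Fixpoint prefix_prod f pre h : R :=
  if h is y :: h' then f pre y * prefix_prod f (rcons pre y) h' else 1.

Lemma prefix_prod_rcons f pre h y :
  prefix_prod f pre (rcons h y) = prefix_prod f pre h * f (pre ++ h) y.
Proof.
elim: h pre => [|z h IH] pre /=; first by rewrite cats0 mulr1 mul1r.
by rewrite IH cat_rcons mulrA.
Qed.

Lemma prefix_prod_ge0 f pre h : (forall g y, 0 <= f g y) -> 0 <= prefix_prod f pre h.
Proof. by move=> f0; elim: h pre => //= y h IH pre; rewrite mulr_ge0. Qed.

Lemma prod_take f n (t : n.-tuple X) :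
  \prod_(i < n) f (take i t) (tnth t i) = prefix_prod f [::] t.
Proof.
suff H pre : \prod_(i < n) f (pre ++ take i t) (tnth t i) = prefix_prod f pre t.
  exact: (H [::]).
elim: n t pre => [|n IH] t pre; first by rewrite big_ord0 (tuple0 t).
case/tupleP: t => y t; rewrite big_ord_recl /= cats0 tnth0 -IH; congr (_ * _).
by apply: eq_bigr => i _; rewrite tnthS cat_rcons.
Qed.

End PrefixProduct.

(** * Policies with simulated rewards *)

Section Simulation.
Variables (R : realType) (S A Zt : finType).
Notation X := (S * A * Zt)%type.

Definition sim_weight (pi : policy R S A Zt) (q : nat -> S -> A -> Zt -> R)
  (h : seq X) (y : X) : R := pi h y.1.1 y.1.2 * q (size h) y.1.1 y.1.2 y.2.

(** The probability that simulated play selects the actions of [x] when its states are imposed; no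
    transition enters. *)
Definition sim_mass pi q (x : seq (S * A)) : R :=
  sum_lifts x (prefix_prod (sim_weight pi q) [::]).

(* The policy that follows [pi] on simulated rewards drawn from [q], with the
   simulated rewards integrated out: its action probabilities are conditional
   probabilities given the past state-action pairs. On null pasts the choice is
   irrelevant. *)
Definition sim_policy pi q : policy R S A Zt := fun h s a =>
  let x := map fst h in
  if sim_mass pi q x == 0 then pi h s a
  else sim_mass pi q (rcons x (s, a)) / sim_mass pi q x.

Variables (pi : policy R S A Zt) (q : nat -> S -> A -> Zt -> R).
Hypotheses (pi_dist : is_policy pi) (q_dist : forall i s a, is_dist (q i s a)).

Lemma sim_weight_ge0 h y : 0 <= sim_weight pi q h y.
Proof.
by rewrite mulr_ge0 //; [case: (pi_dist h y.1.1)|case: (q_dist (size h) y.1.1 y.1.2)].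
Qed.

Lemma sim_mass_ge0 x : 0 <= sim_mass pi q x.
Proof.
by apply: sum_lifts_ge0 => h; apply: prefix_prod_ge0; exact: sim_weight_ge0.
Qed.

(** Summing out the last simulated reward gives 1, then the last action gives 1. This makes the
    quotients in [sim_policy] distributions. *)
Lemma sum_sim_mass x s : \sum_a sim_mass pi q (rcons x (s, a)) = sim_mass pi q x.
Proof.
under eq_bigr do rewrite /sim_mass sum_lifts_rcons.
rewrite -sum_lifts_sum; apply: eq_sum_lifts => h.
transitivity (\sum_a prefix_prod (sim_weight pi q) [::] h * pi h s a).
  apply: eq_bigr => a _; under eq_bigr do rewrite prefix_prod_rcons /= /sim_weight /=.
  by rewrite -!mulr_sumr (q_dist _ s a).2 mulr1.
by rewrite -mulr_sumr (pi_dist h s).2 mulr1.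
Qed.

Lemma sim_policy_is_policy : is_policy (sim_policy pi q).
Proof.
move=> h s; rewrite /sim_policy; case: eqP => [_|/eqP N0]; first exact: pi_dist.
split; first by move=> a; rewrite divr_ge0 ?sim_mass_ge0.
by rewrite -mulr_suml sum_sim_mass divff.
Qed.

(** The quotients telescope. *)
Lemma prefix_prod_sim_policy h :
  prefix_prod (fun h y => sim_policy pi q h y.1.1 y.1.2) [::] h
  = sim_mass pi q (map fst h).
Proof.
elim/last_ind: h => [//|h [[s a] z] IH].
rewrite prefix_prod_rcons IH map_rcons /= /sim_policy; case: eqP => [N0|/eqP N0].
  (* A null past: nonnegative masses that sum to 0 all vanish, so the extension is null too. *)
  rewrite N0 mul0r; apply/esym.
  move: (sum_sim_mass (map fst h) s); rewrite N0 => /eqP.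
  rewrite psumr_eq0 => [/allP/(_ a)|b _]; last exact: sim_mass_ge0.
  by rewrite mem_index_enum => /(_ isT)/eqP.
by rewrite mulrC divfK.
Qed.

Variables (H : nat) (Tk : S -> A -> S -> R) (nu : S -> R).

Lemma init_trans_factor_fst : exists F : seq (S * A) -> R,
  forall h : seq X, init_factor nu h * trans_factor Tk h = F (map fst h).
Proof.
exists (fun x => (if x is p :: _ then nu p.1 else 1)
  * \prod_(p <- zip x (behead x)) Tk p.1.1 p.1.2 p.2.1) => h.
congr (_ * _); first by case: h.
rewrite behead_map /trans_factor.
have -> : forall h1 h2 : seq X, zip (map fst h1) (map fst h2)
    = [seq (p.1.1, p.2.1) | p <- zip h1 h2].
  by elim=> [|y h1 IH] [|y2 h2] //=; rewrite IH.
by rewrite big_map.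
Qed.

Lemma sum_sa_part (F : seq (S * A) -> R) (K : seq X -> R) (E : {set H.-tuple (S * A)}) :
  \sum_(tau : H.-tuple X | sa_part tau \in E) F (map fst tau) * K tau
  = \sum_(x in E) F x * sum_lifts x K.
Proof.
rewrite (partition_big (@sa_part S A Zt H) (mem E)) //=; apply: eq_bigr => x xE.
rewrite -sum_tuple_lifts mulr_sumr; apply: eq_big => tau.
  by rewrite andb_idl // => /eqP ->.
by case/andP=> _ /eqP <-.
Qed.

Variables (M : nat) (w : 'I_M -> R) (mu : 'I_M -> S -> A -> Zt -> R).
Hypotheses (w_dist : is_dist w) (mu_model : is_reward_model mu).

Lemma sum_lifts_reward m x :
  sum_lifts x (prefix_prod (fun _ (y : X) => mu m y.1.1 y.1.2 y.2) [::]) = 1.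
Proof.
elim/last_ind: x => [//|x [s a] IH]; rewrite sum_lifts_rcons -[RHS]IH.
apply: eq_sum_lifts => h; under eq_bigr do rewrite prefix_prod_rcons /=.
by rewrite -mulr_sumr (mu_model m s a).2 mulr1.
Qed.

(** Both sides equal a sum over [x] of [F x * sim_mass pi q x]: on the left the policy factor is
    [sim_mass], which is blind to the true rewards, so these sum out to 1; on the right [sim_mass]
    is expanded. *)
Lemma event_prob_sim_policy (E : {set H.-tuple (S * A)}) :
  event_prob Tk nu w mu (sim_policy pi q) E
  = \sum_(tau : H.-tuple X | sa_part tau \in E)
      init_factor nu tau * trans_factor Tk tau * policy_factor pi tau
      * \prod_(i < H) q i (tnth tau i).1.1 (tnth tau i).1.2 (tnth tau i).2.
Proof.
have [F FE] := init_trans_factor_fst.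
pose mix h := \sum_m w m * prefix_prod (fun _ (y : X) => mu m y.1.1 y.1.2 y.2) [::] h.
transitivity (\sum_(x in E) F x * sim_mass pi q x).
  transitivity (\sum_(tau : H.-tuple X | sa_part tau \in E)
      (F (map fst tau) * sim_mass pi q (map fst tau)) * mix tau).
    apply: eq_bigr => tau _; rewrite /traj_prob FE; congr (_ * _ * _).
      by rewrite -prefix_prod_sim_policy -prod_take.
    by apply: eq_bigr => m _; rewrite -(prod_take _ tau).
  rewrite (sum_sa_part (fun x => F x * sim_mass pi q x)).
  apply: eq_bigr => x _; rewrite sum_lifts_sum.
  under eq_bigr do rewrite sum_liftsZ sum_lifts_reward mulr1.
  by rewrite w_dist.2 mulr1.
rewrite -sum_sa_part; apply: eq_bigr => tau _.
rewrite FE -!mulrA -big_split /= -prod_take; congr (_ * _).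
apply: eq_bigr => i _; rewrite /sim_weight size_take size_tuple.
by rewrite ltn_ord.
Qed.

End Simulation.

(** * Moments indexed by sets of times *)

Lemma moment_subseq_at (R : realType) (S A Zt : finType) M (w : 'I_M -> R)
    (mu : 'I_M -> S -> A -> Zt -> R) d (x : d.-tuple (S * A)) (z : d.-tuple Zt)
    (I : {set 'I_d}) :
  moment w mu (subseq_at x I) (subseq_at z I)
  = \sum_m w m * \prod_(q in I) mu m (tnth x q).1 (tnth x q).2 (tnth z q).
Proof.
apply: eq_bigr => m _; congr (_ * _).
by rewrite /subseq_at zip_map big_map big_enum.
Qed.

Lemma sub_card_exists (T : finType) (J : {set T}) d :
  (#|J| <= d <= #|T|)%N -> exists2 K : {set T}, J \subset K & #|K| = d.
Proof.
move=> /andP[Jd dT].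
pose s := take (d - #|J|) (enum (~: J)).
have size_s : size s = (d - #|J|)%N.
  by rewrite size_takel // -cardE leq_subLR cardsC.
have sJ i : i \in s -> i \notin J by move=> /mem_take; rewrite mem_enum inE.
exists (J :|: [set i in s]); first exact: finset.subsetUl.
have -> : #|J :|: [set i in s]| = (#|J| + #|[set i in s]|)%N.
  rewrite cardsU [J :&: _](_ : _ = finset.set0) ?cards0 ?subn0 //.
  by apply/finset.setP => i; rewrite !inE; apply/andP => -[iJ /sJ]; rewrite iJ.
have /card_uniqP cs : uniq s by rewrite take_uniq ?enum_uniq.
by rewrite cardsE cs size_s subnKC.
Qed.

(** [in_Etot] speaks of exactly [d] increasing times, moments of lower order of fewer. So [J] is
    padded to [d] elements, listed in increasing order, and [I] marks the positions that belong to
    [J]. *)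
Lemma sorted_tuple_cover (R : comNzRingType) H d (J : {set 'I_H}) :
  (#|J| <= d <= H)%N ->
  exists2 t : d.-tuple 'I_H, sorted (fun i j : 'I_H => (i < j)%N) t &
  exists I : {set 'I_d}, forall F : 'I_H -> R,
    \prod_(q in I) F (tnth t q) = \prod_(i in J) F i.
Proof.
move=> JdH; have [|K JK Kd] := @sub_card_exists _ J d; first by rewrite card_ord.
have size_K : size (enum K) == d by rewrite -cardE Kd.
exists (Tuple size_K) => /=.
  rewrite /enum_mem sorted_filter; first by [].
    by move=> ? ? ?; exact: ltn_trans.
  rewrite -(@sorted_map _ _ val ltn) -enumT val_enum_ord.
  exact: iota_ltn_sorted.
exists [set q | tnth (Tuple size_K) q \in J] => F.
transitivity (\prod_(i <- Tuple size_K | i \in J) F i).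
  by rewrite big_tuple; apply: eq_bigl => q; rewrite inE.
rewrite /= big_enum_cond; apply: eq_bigl => i.
by rewrite andb_idl //; exact: (fintype.subsetP JK).
Qed.

Lemma is_dist_le1 (R : realType) (T : finType) (p : T -> R) t : is_dist p -> p t <= 1.
Proof.
by case=> p0 <-; rewrite (bigD1 t) //= lerDl sumr_ge0.
Qed.

Lemma is_dist_inhabited (R : realType) (T : finType) (p : T -> R) : is_dist p -> inhabited T.
Proof.
case=> _ p1; case: (pickP (@predT T)) => [t _|T0]; first by [].
by move: p1; rewrite big_pred0 // => /eqP; rewrite eq_sym oner_eq0.
Qed.

Lemma event_prob_le_sup (R : realType) (S A Zt : finType) H
    (Tk : S -> A -> S -> R) (nu : S -> R) M (w : 'I_M -> R)
    (mu : 'I_M -> S -> A -> Zt -> R) (pi : policy R S A Zt)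
    (E : {set H.-tuple (S * A)}) :
  is_policy pi ->
  event_prob Tk nu w mu pi E <=
  sup [set event_prob Tk nu w mu pi' E | pi' in @is_policy R S A Zt]%classic.
Proof.
move=> pi_dist; apply: ub_le_sup; last by exists pi.
(* Dropping the policy factor, which is at most 1, bounds the set, so that [sup] is not its default
   value. *)
exists (\sum_(tau : H.-tuple (S * A * Zt) | sa_part tau \in E)
  `|init_factor nu tau * trans_factor Tk tau * mixture_factor w mu tau|).
move=> _ [pi' pi'_dist <-]; apply: ler_sum => tau _.
apply: le_trans (ler_norm _) _.
rewrite /traj_prob mulrAC normrM ler_piMr //.
rewrite ger0_norm.
  apply: prodr_ile1 => i _; rewrite (pi'_dist _ _).1 is_dist_le1 //.
by apply: prodr_ge0 => i _; exact: (pi'_dist _ _).1.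
Qed.

(* [t] counts the times whose kernel is already fixed by [c], and [n] those left;
   [e] is the uniform kernel. Either few contexts are left or few times, which is
   what makes a moment order [k] below the number of contexts suffice. *)
Lemma decoupling (R : realDomainType) (T : finType) (P : pred T) (G : T -> R)
  (C : Type) (g : C -> nat -> T -> R) (e : C) (H : nat) (V Z : R) :
  (forall tau, P tau -> 0 <= G tau) ->
  (forall c i tau, 0 <= g c i tau <= 1) ->
  (forall i tau, Z * g e i tau = 1) ->
  0 <= Z -> 0 <= V ->
  (forall c : nat -> C,
    \sum_(tau | P tau) G tau * \prod_(0 <= i < H) g (c i) i tau <= V) ->
  forall n k t (ctx : seq C) (u : C -> T -> R) (c : nat -> C) delta,
  0 <= delta -> (n + t)%N = H -> (size ctx <= k.+1)%N || (n <= k)%N ->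
  (forall tau s, P tau -> uniq s -> all (fun i => t <= i < H)%N s ->
    (size s <= k)%N ->
    `|\sum_(m <- ctx) u m tau * \prod_(i <- s) g m i tau| <= delta) ->
  \sum_(tau | P tau) G tau * (\prod_(0 <= i < t) g (c i) i tau)
     * `|\sum_(m <- ctx) u m tau * \prod_(t <= i < H) g m i tau|
  <= V * (1 + 2 * n%:R * Z) ^+ k * delta.
Proof.
move=> G0 g01 gZ Z0 V0 VP.
have g0 c i tau : 0 <= g c i tau by case/andP: (g01 c i tau).
elim=> [|n IH] k t ctx u c delta d0.
  rewrite add0n => -> _ hmom.
  rewrite mulr0 mul0r addr0 expr1n mulr1.
  apply: (@le_trans _ _ (\sum_(tau | P tau)
      (G tau * \prod_(0 <= i < H) g (c i) i tau) * delta)); last first.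
    by rewrite -mulr_suml ler_wpM2r.
  apply: ler_sum => tau Ptau; apply: ler_wpM2l.
    by rewrite mulr_ge0 ?G0 // prodr_ge0.
  (* With no time left, the signed sum is the moment of order 0. *)
  have := hmom tau [::] Ptau isT isT isT.
  congr (`| _ | <= _); apply: eq_bigr => m _.
  by rewrite big_nil big_geq.
move=> nt hk hmom.
have B0 (j l : nat) : 0 <= 1 + 2 * j%:R * Z :> R.
  by rewrite addr_ge0 // !mulr_ge0.
case: ctx hk hmom => [|L ctx] hk hmom.
  rewrite big1; first by rewrite !mulr_ge0 ?exprn_ge0 ?B0.
  by move=> tau _; rewrite big_nil normr0 mulr0.
have tH : (t < H)%N by rewrite -nt addSn ltnS leq_addl.
pose upd b i := if i == t then b else c i.
have updE b tau : \prod_(0 <= i < t.+1) g (upd b i) i tau =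
    (\prod_(0 <= i < t) g (c i) i tau) * g b t tau.
  rewrite big_nat_recr //= /upd eqxx; congr (_ * _).
  by apply: eq_big_nat => i /andP[_ it]; rewrite ltn_eqF.
(* These weights vanish at [L], so [X2] runs over [ctx] only. *)
pose u' m tau := u m tau * (g m t tau - g L t tau).
set X1 := fun tau => \sum_(m <- L :: ctx) u m tau * \prod_(t.+1 <= i < H) g m i tau.
set X2 := fun tau => \sum_(m <- ctx) u' m tau * \prod_(t.+1 <= i < H) g m i tau.
have split_ctx tau : \sum_(m <- L :: ctx) u m tau * \prod_(t <= i < H) g m i tau
    = g L t tau * X1 tau + X2 tau.
  have -> : X2 tau = \sum_(m <- L :: ctx) u' m tau * \prod_(t.+1 <= i < H) g m i tau.
    by rewrite big_cons {1}/u' subrr mulr0 mul0r add0r.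
  rewrite /X1 mulr_sumr -big_split /=; apply: eq_bigr => m _.
  by rewrite big_ltn // /u'; ring.
have sub1 : \sum_(tau | P tau) G tau * (\prod_(0 <= i < t.+1) g (upd L i) i tau)
     * `|X1 tau| <= V * (1 + 2 * n%:R * Z) ^+ k * delta.
  apply: IH => //; first by rewrite addnS -addSn.
    by case/orP: hk => [->//|/ltnW ->]; rewrite orbT.
  move=> tau s Ptau us /allP hs sk; apply: hmom => //.
  by apply/allP => i /hs /andP[/ltnW -> ->].
(* One context and one moment order are lost; at order 0 [hk] leaves no context besides [L], so [X2]
   is 0. *)
have sub2 : \sum_(tau | P tau) G tau * (\prod_(0 <= i < t.+1) g (upd e i) i tau)
     * `|X2 tau| <= V * (if k is k'.+1 then (1 + 2 * n%:R * Z) ^+ k' else 0) * (2 * delta).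
  clear sub1; case: k hk hmom => [|k] hk hmom.
    have ctx0 : ctx = [::] by case: (ctx) hk.
    rewrite mulr0 mul0r big1 // => tau _.
    by rewrite /X2 ctx0 big_nil normr0 mulr0.
  apply: IH => //; [by rewrite mulr_ge0|by rewrite addnS -addSn|].
  move=> tau s Ptau us /allP hs sk.
  (* Including time [t] or not gives two moments of [u]; as [g L t tau <= 1], this is where
     [2 * delta] comes from. *)
  have -> : \sum_(m <- ctx) u' m tau * \prod_(i <- s) g m i tau =
     (\sum_(m <- L :: ctx) u m tau * \prod_(i <- t :: s) g m i tau)
     - g L t tau * \sum_(m <- L :: ctx) u m tau * \prod_(i <- s) g m i tau.
    rewrite mulr_sumr -sumrB big_cons big_cons.
    rewrite [X in _ = X + _](_ : _ = 0) ?add0r; last by ring.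
    by apply: eq_bigr => m _; rewrite big_cons /u'; ring.
  rewrite mulr_natl mulr2n (le_trans (ler_normB _ _)) // lerD //.
    apply: hmom => //=.
      rewrite us andbT; apply/negP => /hs; by rewrite ltnn.
    rewrite leqnn tH; apply/allP => i /hs /andP[/ltnW -> ->] //.
  rewrite normrM ger0_norm // -[leRHS]mul1r ler_pM //.
    by case/andP: (g01 L t tau).
  apply: hmom => //; last exact: leqW.
  by apply/allP => i /hs /andP[/ltnW -> ->].
(* The second part has no kernel at time [t]; the uniform one is inserted and [Z] cancels it. *)
apply: (@le_trans _ _ (\sum_(tau | P tau)
   (G tau * (\prod_(0 <= i < t.+1) g (upd L i) i tau) * `|X1 tau|
   + Z * (G tau * (\prod_(0 <= i < t.+1) g (upd e i) i tau) * `|X2 tau|)))).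
  apply: ler_sum => tau Ptau.
  rewrite split_ctx !updE.
  set a := \prod_(0 <= i < t) _.
  have Ga : 0 <= G tau * a by rewrite mulr_ge0 ?G0 // prodr_ge0.
  have -> : Z * (G tau * (a * g e t tau) * `|X2 tau|) = G tau * a * `|X2 tau|.
    by rewrite -[RHS]mul1r -(gZ t tau); ring.
  have -> : G tau * (a * g L t tau) * `|X1 tau| = G tau * a * `|g L t tau * X1 tau|.
    by rewrite normrM (ger0_norm (g0 L t tau)); ring.
  by rewrite -mulrDr ler_wpM2l // ler_normD.
rewrite big_split /= -mulr_sumr.
apply: le_trans (lerD sub1 (ler_wpM2l Z0 sub2)) _.
clear hk hmom sub1 sub2; case: k => [|k].
  by rewrite mulr0 mul0r mulr0 addr0 !expr0.
have le1 : (1 + 2 * n%:R * Z) ^+ k <= (1 + 2 * n.+1%:R * Z) ^+ k.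
  rewrite lerXn2r ?nnegrE ?B0 // lerD2l ler_wpM2r // ler_wpM2l // ler_nat.
  exact: leqnSn.
(* The recursion closes because [(1 + 2 * n * Z) + 2 * Z = 1 + 2 * (n + 1) * Z]. *)
have -> : V * (1 + 2 * n%:R * Z) ^+ k.+1 * delta
   + Z * (V * (1 + 2 * n%:R * Z) ^+ k * (2 * delta))
  = (1 + 2 * n%:R * Z) ^+ k * (V * (1 + 2 * n.+1%:R * Z) * delta).
  by rewrite exprS -natr1; ring.
have -> : V * (1 + 2 * n.+1%:R * Z) ^+ k.+1 * delta =
   (1 + 2 * n.+1%:R * Z) ^+ k * (V * (1 + 2 * n.+1%:R * Z) * delta).
  by rewrite exprS; ring.
by rewrite ler_wpM2r // !mulr_ge0 ?B0.
Qed.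

(** * The bound for two models *)

Local Open Scope classical_set_scope.
Theorem theorem2 (R : realType) (S A Zt : finType) (zval : Zt -> R) (H : nat)
  (Tk : S -> A -> S -> R) (nu : S -> R)
  (M1 : nat) (w1 : 'I_M1 -> R) (mu1 : 'I_M1 -> S -> A -> Zt -> R)
  (M2 : nat) (w2 : 'I_M2 -> R) (mu2 : 'I_M2 -> S -> A -> Zt -> R)
  (delta : R) :
  is_reward_support zval -> is_kernel Tk -> is_dist nu ->
  is_dist w1 -> is_reward_model mu1 ->
  is_dist w2 -> is_reward_model mu2 ->
  0 < delta ->
  let d := minn H (M1 + M2 - 1) in
  forall E : {set H.-tuple (S * A)},
  (forall x, x \in E -> in_Etot d w1 mu1 w2 mu2 delta x) ->
  forall pi : policy R S A Zt, is_policy pi ->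
  \sum_(tau : H.-tuple (S * A * Zt) | sa_part tau \in E)
     `|traj_prob Tk nu w1 mu1 pi tau - traj_prob Tk nu w2 mu2 pi tau|
  <= sup [set event_prob Tk nu w1 mu1 pi' E | pi' in @is_policy R S A Zt]
     * ((4 * H * #|Zt|)%:R ^+ d) * delta.
Proof.
move=> _ Tk_dist nu_dist w1_dist mu1_model w2_dist mu2_model delta0 d E E_tot pi pi_dist.
(* Distributions sum to 1, hence [S], [A], ['I_M1] and [Zt] are inhabited; this gives a default for
   [nth] and [0 < #|Zt|]. *)
have [s0] := is_dist_inhabited nu_dist.
have [a0] := is_dist_inhabited (pi_dist [::] s0).
have [m0] := is_dist_inhabited w1_dist.
have [z0] := is_dist_inhabited (mu1_model m0 s0 a0).
have Zt_gt0 : (0 < #|Zt|)%N by apply/card_gt0P; exists z0.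
pose x0 : S * A * Zt := (s0, a0, z0).
(* Kernels of both models, with [None] for the uniform one. *)
pose C := option ('I_M1 + 'I_M2).
pose kern (c : C) : S -> A -> Zt -> R := match c with
  | Some (inl m) => mu1 m | Some (inr m) => mu2 m
  | None => fun _ _ _ => #|Zt|%:R^-1 end.
have kern_dist c s a : is_dist (kern c s a).
  case: c => [[m|m]|] //=; split=> [z|]; first by rewrite invr_ge0.
  by rewrite sumr_const -[RHS](@mulVf _ #|Zt|%:R) ?pnatr_eq0 -?lt0n // mulr_natr.
pose g (c : C) i (tau : H.-tuple (S * A * Zt)) : R :=
  kern c (nth x0 tau i).1.1 (nth x0 tau i).1.2 (nth x0 tau i).2.
have gE c (i : 'I_H) (tau : H.-tuple (S * A * Zt)) :
    g c i tau = kern c (tnth tau i).1.1 (tnth tau i).1.2 (tnth tau i).2.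
  by rewrite /g -tnth_nth.
(* The second model enters with negative weights; [None] is absent from [ctx]. *)
pose u (c : C) (tau : H.-tuple (S * A * Zt)) : R := match c with
  | Some (inl m) => w1 m | Some (inr m) => - w2 m | None => 0 end.
pose ctx : seq C := map Some (enum {: 'I_M1 + 'I_M2}).
have sum_ctx (f : C -> R) tau : \sum_(c <- ctx) u c tau * f c =
    \sum_m w1 m * f (Some (inl m)) - \sum_m w2 m * f (Some (inr m)).
  rewrite big_map big_enum big_sumType /= -sumrN; congr (_ + _).
  by apply: eq_bigr => m _; rewrite mulNr.
pose G (tau : H.-tuple (S * A * Zt)) :=
  init_factor nu tau * trans_factor Tk tau * policy_factor pi tau.
have G_ge0 tau : 0 <= G tau.
  rewrite /G; apply: mulr_ge0; first apply: mulr_ge0.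
  - by rewrite /init_factor; case: (tval tau) => // y _; exact: nu_dist.1.
  - by apply: prodr_ge0 => p _; exact: (Tk_dist _ _).1.
  - by apply: prodr_ge0 => i _; exact: (pi_dist _ _).1.
set V := sup _.
(* Rewards of any kind, even from the second model, can be simulated in the first, so its supremum
   suffices. *)
have V_bound (c : nat -> C) : \sum_(tau : H.-tuple (S * A * Zt) | sa_part tau \in E)
    G tau * \prod_(0 <= i < H) g (c i) i tau <= V.
  have q_dist i s a : is_dist (kern (c i) s a) by [].
  apply: le_trans (event_prob_le_sup Tk nu w1 mu1 E (sim_policy_is_policy pi_dist q_dist)).
  rewrite (event_prob_sim_policy pi_dist q_dist Tk nu w1_dist mu1_model).
  apply: ler_sum => tau _; rewrite big_mkord le_eqVlt; apply/orP; left; apply/eqP.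
  by congr (_ * _); apply: eq_bigr => i _; rewrite gE.
have V_ge0 : 0 <= V.
  apply: le_trans (V_bound (fun=> None)); apply: sumr_ge0 => tau _.
  by rewrite mulr_ge0 // prodr_ge0 // => i _; exact: (kern_dist _ _ _).1.
have g01 c i tau : 0 <= g c i tau <= 1.
  by apply/andP; split; [exact: (kern_dist _ _ _).1|exact: (is_dist_le1 _ (kern_dist _ _ _))].
have gZ i tau : #|Zt|%:R * g None i tau = 1.
  by rewrite mulfV // pnatr_eq0 -lt0n.
have moments tau s : sa_part tau \in E -> uniq s ->
    all (fun i => 0 <= i < H)%N s -> (size s <= d)%N ->
    `|\sum_(c <- ctx) u c tau * \prod_(i <- s) g c i tau| <= delta.
  move=> tauE us /allP sH sd.
  pose J := [set i : 'I_H | val i \in s]%SET.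
  have sJ : perm_eq s (map val (enum J)).
    apply: uniq_perm => //; first by rewrite map_inj_uniq ?enum_uniq //; exact: val_inj.
    move=> i; apply/idP/mapP => [si|[j]]; last by rewrite mem_enum inE => ? ->.
    by have iH := sH _ si; exists (Ordinal iH); rewrite // mem_enum inE.
  have JdH : (#|J| <= d <= H)%N.
    by rewrite geq_minl cardE -(size_map val) -(perm_size sJ) sd.
  have [t t_sorted [I It]] := @sorted_tuple_cover R H d J JdH.
  pose z := [tuple (tnth tau (tnth t q)).2 | q < d].
  have := E_tot _ tauE t t_sorted z I.
  rewrite !moment_subseq_at sum_ctx.
  congr (`| _ - _ | <= _); apply: eq_bigr => m _; congr (_ * _);
    rewrite (perm_big _ sJ) big_map big_enum -It; apply: eq_bigr => q _;
    by rewrite !tnth_mktuple tnth_map gE.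
(* Either [d = H], or [d + 1] is the number of contexts; [M1 > 0] keeps the truncated subtraction
   exact. *)
have ctx_d : (size ctx <= d.+1)%N || (H <= d)%N.
  rewrite size_map -cardE card_sum !card_ord /d.
  have M_gt0 : (0 < M1 + M2)%N by rewrite addn_gt0 (leq_ltn_trans _ (ltn_ord m0)).
  by rewrite /minn; case: ltnP => _; rewrite ?leqnn ?orbT // subn1 prednK // leqnn.
have := decoupling (fun tau _ => G_ge0 tau) g01 gZ (ler0n _ _) V_ge0 V_bound
  (fun=> None) (ltW delta0) (addn0 H) ctx_d moments.
move=> bound; apply: le_trans (le_trans _ bound) _.
  apply: ler_sum => tau _; rewrite big_geq // mulr1 /traj_prob -mulrBr normrM.
  rewrite ger0_norm ?G_ge0 // ler_wpM2l ?G_ge0 // sum_ctx le_eqVlt; apply/orP; left.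
  apply/eqP; congr (`| _ - _ |); apply: eq_bigr => m _; congr (_ * _);
    by rewrite big_mkord; apply: eq_bigr => i _; rewrite gE.
rewrite ler_wpM2r ?(ltW delta0) // ler_wpM2l //.
(* For [H = 0] the exponent is 0; otherwise [1 <= 2 * H * #|Zt|] gives the base [4 * H * #|Zt|]. *)
case: (posnP H) => [H0|H_gt0]; first by rewrite /d H0 min0n !expr0.
have -> : 1 + 2 * H%:R * #|Zt|%:R = (1 + 2 * H * #|Zt|)%:R :> R.
  by rewrite natrD !natrM.
rewrite lerXn2r ?nnegrE ?ler0n // ler_nat.
have -> : (4 * H * #|Zt| = 2 * H * #|Zt| + 2 * H * #|Zt|)%N.
  by rewrite -!mulnDl.
by rewrite leq_add2r !muln_gt0 H_gt0 Zt_gt0.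
Qed.
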